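(* Let $n\ge2$, let $D:=\mathcal{S}^4_{\mathrm{sparse}}\subset\mathbb{S}^{n\times n}$ be the convex hull of all matrices $P^{(ij)}$ and $N^{(ij)}$, $i\ne j$, and let $f$ be a convex differentiable real-valued function on $\mathbb{S}^{n\times n}$ with finite curvature constant $C_f$ with respect to $D$. Let $X^*\in D$ be an optimal solution of $\min_{X\in D}f(X)$, and let $X^{(0)}:=P^{(12)}$ be the starting point of the algorithm ''Greedy on a Convex Set'' over $D$. Then for each $k\ge1$, the iterate $X^{(k)}$ of the algorithm has at most $4(k+1)$ non-zero entries, and satisfies $$f(X^{(k)})-f(X^* )\le\frac{8C_f}{k+2}.$$ Furthermore, for any $\varepsilon>0$, after at most $2\left\lceil\frac{8C_f}{\varepsilon}\right\rceil+1=O\left(\frac1\varepsilon\right)$ many steps, the algorithm (with the step-size in the second half of the iterations fixed to $\frac{2}{K+2}$, where $K:=\lceil8C_f/\varepsilon\rceil$) has an iterate $X^{(k)}$ of only $O\left(\frac1\varepsilon\right)$ many non-zero entries, satisfying $g(X^{(k)})\le\varepsilon$.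
   Context: $\mathbb{S}^{n\times n}$ is the space of symmetric real $n\times n$ matrices with Frobenius inner product $A\bullet B:=\mathrm{Tr}(A^TB)$, with respect to which gradients are taken. For $i\ne j$ in $\{1,\dots,n\}$, with $\mathbf{e}_i$ the standard unit vectors, $$P^{(ij)}:=(\mathbf{e}_i+\mathbf{e}_j)(\mathbf{e}_i+\mathbf{e}_j)^T,\qquad N^{(ij)}:=(\mathbf{e}_i-\mathbf{e}_j)(\mathbf{e}_i-\mathbf{e}_j)^T .$$ The $O(\cdot)$ is for $\varepsilon\to0$, with constant depending only on $C_f$. Curvature constant: $$C_f:=\sup_{\substack{X,V\in D,\ \alpha\in(0,1],\\ Y=X+\alpha(V-X)}}\frac{1}{\alpha^2}\bigl(f(Y)-f(X)-(Y-X)\bullet\nabla f(X)\bigr).$$ Duality gap at $X\in D$: $g(X):=\max_{Y\in D}(X-Y)\bullet\nabla f(X)$. Algorithm ''Greedy on a Convex Set'' over $D$: for $k=0,1,2,\dots$, let $\alpha:=\frac{2}{k+2}$; let $S$ be one of the matrices $P^{(ij)}$, $N^{(ij)}$ minimizing $S\bullet\nabla f(X^{(k)})$ among all these matrices (equivalently, attaining $\min_{Y\in D}Y\bullet\nabla f(X^{(k)})$); update $X^{(k+1)}:=X^{(k)}+\alpha(S-X^{(k)})$. For the duality gap statement, the step-sizes are $\alpha=\frac{2}{k+2}$ for $0\le k\le K$ and $\alpha=\frac{2}{K+2}$ for $K\le k\le2K+1$. *)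

(* Defs.v *)
From HB Require Import structures.
From mathcomp Require Import all_boot all_order all_algebra ring.
From mathcomp Require Import all_classical all_reals all_analysis.

Set Implicit Arguments.
Unset Strict Implicit.
Unset Printing Implicit Defensive.

Import Order.TTheory GRing.Theory Num.Theory.
Import numFieldNormedType.Exports.

Local Open Scope classical_set_scope.
Local Open Scope ring_scope.

Section SymmetricMatrices.
Variables (R : realType) (n : nat).

Definition symmetric_pred : pred 'M[R]_n := fun A => A^T == A.
Definition symmetric := [qualify a A : 'M[R]_n | symmetric_pred A].

Lemma symmetric_submod_closed : submod_closed symmetric.
Proof.
split=> [|a A B]; rewrite !qualifE /= /symmetric_pred ?trmx0 //.
by move=> /eqP As /eqP Bs; rewrite linearP /= As Bs.
Qed.

HB.instance Definition _ :=
  GRing.isSubmodClosed.Build R 'M[R]_n symmetric_pred symmetric_submod_closed.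

Record symmx := Symmx { symmx_val :> 'M[R]_n; _ : symmx_val \is a symmetric }.

HB.instance Definition _ := [isSub for symmx_val].
HB.instance Definition _ := [Choice of symmx by <:].
HB.instance Definition _ := [SubChoice_isSubLmodule of symmx by <:].

Definition frob (A B : symmx) : R := \tr ((val A)^T *m val B).

Lemma frobE A B : frob A B = \sum_i \sum_j val A i j * val B i j.
Proof.
rewrite /frob /mxtrace exchange_big /=; apply: eq_bigr => j _.
by rewrite mxE; apply: eq_bigr => i _; rewrite mxE.
Qed.

Lemma frobC A B : frob A B = frob B A.
Proof.
by rewrite !frobE; apply: eq_bigr => i _; apply: eq_bigr => j _; rewrite mulrC.
Qed.

Lemma frobDl A B C : frob (A + B) C = frob A C + frob B C.
Proof. by rewrite /frob !raddfD mulmxDl raddfD. Qed.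

Lemma frobZl a A B : frob (a *: A) B = a * frob A B.
Proof.
have -> : frob (a *: A) B = \tr ((a *: val A)^T *m val B) by [].
by rewrite linearZ -scalemxAl mxtraceZ.
Qed.

Lemma frob_ge0 A : 0 <= frob A A.
Proof.
by rewrite frobE; do 2 apply: sumr_ge0 => ? _; rewrite -expr2 sqr_ge0.
Qed.

Lemma frob_eq0 A : frob A A = 0 -> A = 0.
Proof.
rewrite frobE => /eqP; rewrite psumr_eq0 => [/allP A0|i _]; last first.
  by apply: sumr_ge0 => j _; rewrite -expr2 sqr_ge0.
apply/val_inj/matrixP => i j; rewrite raddf0 mxE.
have /= := A0 i (mem_index_enum _); rewrite psumr_eq0 => [/allP|k _]; last first.
  by rewrite -expr2 sqr_ge0.
by move=> /(_ j (mem_index_enum _)) /=; rewrite mulf_eq0 orbb => /eqP.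
Qed.

Lemma frob_cauchy_schwarz A B : frob A B ^+ 2 <= frob A A * frob B B.
Proof.
have [/frob_eq0 ->|B0] := eqVneq (frob B B) 0.
  rewrite -(scale0r (0 : symmx)) frobC frobZl frobC frobZl.
  by rewrite !(mul0r, mulr0) expr0n.
have Bp : 0 < frob B B by rewrite lt_def B0 frob_ge0.
have := frob_ge0 (frob B B *: A + (- frob A B) *: B).
rewrite frobDl !frobZl ![frob _ (_ + _)]frobC !frobDl !frobZl (frobC B A).
move: (frob A A) (frob A B) (frob B B) Bp => a b c c0 h.
rewrite -subr_ge0 -(pmulr_rge0 _ c0); apply: le_trans h _.
rewrite le_eqVlt; apply/orP; left; apply/eqP; ring.
Qed.

Definition frob_norm (A : symmx) : R := Num.sqrt (frob A A).

Lemma ler_frob_normD A B : frob_norm (A + B) <= frob_norm A + frob_norm B.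
Proof.
rewrite -(@ler_pXn2r _ 2) ?nnegrE ?addr_ge0 ?sqrtr_ge0 // sqrrD.
rewrite !sqr_sqrtr ?frob_ge0 // frobDl ![frob _ (_ + _)]frobC !frobDl.
rewrite (frobC B A) addrA lerD2r -addrA lerD2l -mulr2n ler_wMn2r //.
rewrite /frob_norm -sqrtrM ?frob_ge0 //.
apply: le_trans (ler_norm _) _; rewrite -sqrtr_sqr.
exact/ler_wsqrtr/frob_cauchy_schwarz.
Qed.

Lemma frob_normZ a A : frob_norm (a *: A) = `|a| * frob_norm A.
Proof.
rewrite /frob_norm frobZl frobC frobZl mulrA -expr2.
by rewrite sqrtrM ?sqr_ge0 // sqrtr_sqr.
Qed.

Lemma frob_norm_eq0 A : frob_norm A = 0 -> A = 0.
Proof.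
move/eqP; rewrite sqrtr_eq0 => A0; apply: frob_eq0.
by apply/eqP; rewrite eq_le A0 frob_ge0.
Qed.

HB.instance Definition _ :=
  Lmodule_isNormed.Build R symmx ler_frob_normD frob_normZ frob_norm_eq0.

(* The Riesz representative of the differential for the Frobenius inner product;
   it exists by [gradientP]. *)
Definition gradient (f : symmx -> R) (X : symmx) : symmx :=
  get (fun G : symmx => forall H, 'd f X H = frob G H).

Lemma sym_part_symmetric (A : 'M[R]_n) : 2^-1 *: (A + A^T) \is a symmetric.
Proof.
by rewrite qualifE /= /symmetric_pred linearZ raddfD /= trmxK addrC.
Qed.

Lemma gradientP (f : symmx -> R) X H : 'd f X H = frob (gradient f X) H.
Proof.
suff [G GP] : exists G : symmx, forall H, 'd f X H = frob G H.
  by rewrite /gradient; case: xgetP => [? _ -> //|/(_ G)/(_ GP)].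
pose E i j := Symmx (sym_part_symmetric (delta_mx i j)).
have EC i j : E i j = E j i.
  by apply/val_inj; rewrite /= !trmx_delta addrC.
have Gs : \matrix_(i, j) 'd f X (E i j) \is a symmetric.
  rewrite qualifE /= /symmetric_pred; apply/eqP/matrixP => i j.
  by rewrite !mxE EC.
exists (Symmx Gs) => {}H; rewrite frobE.
have vsum (F : 'I_n -> symmx) : val (\sum_i F i) = \sum_i val (F i).
  exact: (big_morph val (fun _ _ => erefl) erefl).
have {1}-> : H = \sum_i \sum_j val H i j *: E i j.
  have /eqP Hs := valP H; apply/val_inj; rewrite vsum.
  have {1}-> : val H = 2^-1 *: (val H + (val H)^T).
    by rewrite Hs -[val H in RHS]scale1r -scalerDl scalerA mulVf ?scale1r ?pnatr_eq0.
  rewrite {1 2}[val H]matrix_sum_delta raddf_sum -big_split scaler_sumr /=.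
  apply: eq_bigr => i _; rewrite vsum raddf_sum -big_split scaler_sumr /=.
  apply: eq_bigr => j _; rewrite [in LHS]linearZ -scalerDr scalerA mulrC /=.
  by rewrite -scalerA.
rewrite linear_sum; apply: eq_bigr => i _; rewrite linear_sum.
by apply: eq_bigr => j _; rewrite linearZ /= mxE mulrC.
Qed.

Lemma outer_symmetric (v : 'cV[R]_n) : v *m v^T \is a symmetric.
Proof. by rewrite qualifE /= /symmetric_pred trmx_mul trmxK. Qed.

Definition outer (v : 'cV[R]_n) : symmx := Symmx (outer_symmetric v).

Definition unit_cv (i : 'I_n) : 'cV[R]_n := delta_mx i 0.

Definition P_mx (i j : 'I_n) : symmx := outer (unit_cv i + unit_cv j).
Definition N_mx (i j : 'I_n) : symmx := outer (unit_cv i - unit_cv j).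

Definition sparse4_atoms : set symmx :=
  [set S | exists i j, i != j /\ (S = P_mx i j \/ S = N_mx i j)].

Definition sparse4 : set symmx := smallest (@convex_set R symmx) sparse4_atoms.

Definition curvature (f : symmx -> R) (D : set symmx) : \bar R :=
  ereal_sup [set e | exists X V a,
    let Y := X + a *: (V - X) in
    [/\ D X, D V, 0 < a <= 1 &
        e = ((a ^+ 2)^-1 * (f Y - f X - frob (Y - X) (gradient f X)))%:E]].

(* An [ereal_sup] rather than a maximum: [sparse4] is a polytope, so for
   [D := sparse4] the supremum is attained and finite. *)
Definition duality_gap (f : symmx -> R) (D : set symmx) (X : symmx) : \bar R :=
  ereal_sup [set (frob (X - Y) (gradient f X))%:E | Y in D].

Definition greedy_step (f : symmx -> R) (a : R) (X X' : symmx) : Prop :=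
  exists S, [/\ sparse4_atoms S,
    forall T, sparse4_atoms T ->
      frob S (gradient f X) <= frob T (gradient f X) &
    X' = X + a *: (S - X)].

Definition nnz (X : symmx) : nat :=
  #|[set p : 'I_n * 'I_n | val X p.1 p.2 != 0]|.

End SymmetricMatrices.

Section StepSizes.
Variable R : realType.

Definition step_size (k : nat) : R := 2 / (k + 2)%:R.

Definition half_fixed_step_size (K k : nat) : R :=
  if (k <= K)%N then step_size k else step_size K.

(* The argument of the ceiling is nonnegative whenever [C] is a curvature
   constant and [0 < eps], so [absz] only casts from [int] to [nat]. *)
Definition gap_threshold (C eps : R) : nat := `|Num.ceil (8 * C / eps)|%N.

End StepSizes.

(* Main.v *)
Require Import Defs.
From HB Require Import structures.
From mathcomp Require Import all_boot all_order all_algebra ring lra.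
From mathcomp Require Import all_classical all_reals all_analysis.

(** This is the Frank-Wolfe method on the polytope spanned by the matrices
    [P_mx i j] and [N_mx i j]; write [h k := f (X k) - f Xopt] and let [g k] be
    the duality gap at [X k].

    Sparsity holds because each atom is supported on a 2 x 2 principal
    submatrix, so a step adds at most four non-zero entries.

    For the objective, the linear function [frob _ (gradient f (X k))] attains
    its minimum over the convex hull at an atom, so the greedy atom is also the
    best direction within [sparse4]; the definition of the curvature constant
    then gives, with step size [a],
      [h k.+1 <= h k - a * g k + a ^+ 2 * C]          ([greedy_descent]).
    By convexity [h k <= g k] ([convex_gradient_le]), so
      [h k.+1 <= (1 - a) * h k + a ^+ 2 * C],
    and for [a = 2 / (k + 2)] induction yields [h k <= 4 * C / (k + 2)] for all
    [k >= 1] ([step_recurrence_bound]). The induction can start at [k = 1]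
    because the very first step has size 1 and forgets the starting point.

    For the duality gap, suppose that [g k > eps] for every [k] from [K + 1] to
    [2 * K + 1]. Each of these [K + 1] steps has size [2 / (K + 2)] and lowers
    [h] by at least [2 / (K + 2) * eps - (2 / (K + 2)) ^+ 2 * C]. Altogether
    the decrease is more than [eps / 2], because [8 * C <= K * eps], whereas
    [h (K + 1) <= 4 * C / (K + 3) < eps / 2] by the first part. So [h] would
    become negative, against the optimality of [Xopt] ([greedy_gap]). Starting
    at [K + 1] rather than at [K] makes the argument cover [K = 0] as well. *)

Set Implicit Arguments.
Unset Strict Implicit.
Unset Printing Implicit Defensive.

Import Order.TTheory GRing.Theory Num.Theory.
Import numFieldNormedType.Exports.

Local Open Scope classical_set_scope.
Local Open Scope ring_scope.

(** * Linear functions on the convex hull of the atoms *)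

Section ConvexHull.
Variables (R : realType) (n : nat).
Implicit Types (X Y V S G : symmx R n) (a : R).

Lemma frobNl X Y : frob (- X) Y = - frob X Y.
Proof. by rewrite -scaleN1r frobZl mulN1r. Qed.

Lemma conv_segment X V (t : {i01 R}) :
  conv t (V : convex_lmodType (symmx R n)) X = X + t%:num *: (V - X).
Proof. by rewrite /conv /= scalerBl scale1r scalerBr addrCA. Qed.

Lemma sparse4_segment X V a : sparse4 X -> sparse4 V -> 0 <= a <= 1 ->
  sparse4 (X + a *: (V - X)).
Proof.
move=> DX DV /andP[a0 a1] A HA; rewrite -(conv_segment X V (Itv01 a0 a1)).
have [cA _] := HA.
by apply: set_mem; apply: cA; apply/mem_set; [exact: DV|exact: DX].
Qed.

Lemma convex_set_halfspace G (b : R) :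
  @convex_set R (symmx R n) [set Y | b <= frob Y G].
Proof.
move=> X Y t /set_mem /= bX /set_mem /= bY; apply/mem_set.
rewrite /= conv_segment.
have -> : Y + t%:num *: (X - Y) = t%:num *: X + (1 - t%:num) *: Y.
  by rewrite scalerBl scale1r scalerBr addrCA.
rewrite frobDl !frobZl.
have t0 : 0 <= t%:num by []. have t1 : t%:num <= 1 by []. nra.
Qed.

(** A half-space that contains the atoms contains their convex hull, so that
    minimizing over the atoms solves the linear problem over [sparse4]. *)
Lemma sparse4_linear_min S G :
  (forall T, sparse4_atoms T -> frob S G <= frob T G) ->
  forall Y, sparse4 Y -> frob S G <= frob Y G.
Proof.
by move=> Smin; exact: (smallest_sub (@convex_set_halfspace G (frob S G))).
Qed.

(** The difference quotients of [f] at [X] in the direction [Y - X], for steps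
    in [(0, 1]], are at most [f Y - f X] by convexity; the inner product with
    the gradient is their limit. *)
Lemma convex_gradient_le (f : symmx R n -> R) X Y :
  convex_function setT f -> differentiable f X ->
  frob (Y - X) (gradient f X) <= f Y - f X.
Proof.
move=> cf df; rewrite frobC -gradientP -(deriveE _ df).
have /cvg_dnbhs_at_right dfXY := @diff_derivable _ _ _ f X (Y - X) df.
apply: (cvgr_to_le dfXY).
near=> t; rewrite /=.
have t0 : 0 < t by near: t; exact: nbhs_right_gt.
have t1 : t <= 1 by near: t; exact: nbhs_right_le.
rewrite ler_pdivrMl // lerBlDr addrC.
have := cf (Itv01 (ltW t0) t1) Y X (mem_setT _) (mem_setT _).
rewrite conv_segment convRE /= addrC => /le_trans; apply.
by rewrite le_eqVlt; apply/orP; left; apply/eqP; rewrite /unstable.onem; ring.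
Unshelve. all: by end_near. Qed.

End ConvexHull.

(** * Progress of one greedy step *)

Section GreedyStep.
Variables (R : realType) (n : nat).
Implicit Types (X Y S : symmx R n) (f : symmx R n -> R) (a C : R).

Lemma greedy_step_sparse4 f a X X' : sparse4 X -> 0 <= a <= 1 ->
  greedy_step f a X X' -> sparse4 X'.
Proof.
move=> DX a01 [S [aS _ ->]].
exact: sparse4_segment DX (sub_gen_smallest aS) a01.
Qed.

Lemma curvature_ge0 f C X :
  curvature f (@sparse4 R n) = C%:E -> sparse4 X -> 0 <= C.
Proof.
move=> fC DX; rewrite -lee_fin -fC.
(* The degenerate segment from [X] to itself contributes the value 0. *)
apply: ereal_sup_ubound; exists X, X, 1.
split=> //; first by rewrite ltr01 lexx.
by rewrite subrr scaler0 addr0 !subrr -(scale0r X) frobZl mul0r subr0 mulr0.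
Qed.

(** The supremum over [Y] of the inner products on the right-hand side is the
    duality gap. Keeping [Y] free serves twice: [Y := Xopt] gives the
    convergence rate, and a [Y] that witnesses a large gap gives a decrease. *)
Lemma greedy_descent f C a X X' Y :
  curvature f (@sparse4 R n) = C%:E -> sparse4 X -> 0 < a <= 1 ->
  greedy_step f a X X' -> sparse4 Y ->
  f X' <= f X - a * frob (X - Y) (gradient f X) + a ^+ 2 * C.
Proof.
move=> fC DX a01 [S [aS Smin ->]] DY.
have DS : sparse4 S := sub_gen_smallest aS.
have SY := sparse4_linear_min Smin DY.
have /andP[a0 _] := a01.
have : (((a ^+ 2)^-1 * (f (X + a *: (S - X)) - f X -
        frob (X + a *: (S - X) - X) (gradient f X)))%:E <= C%:E)%E.
  by rewrite -fC; apply: ereal_sup_ubound; exists X, S, a.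
rewrite lee_fin ler_pdivrMl ?exprn_gt0 // [X + _ - X]addrAC subrr add0r frobZl.
move: SY; rewrite !frobDl !frobNl => SY h.
nra.
Qed.

End GreedyStep.

(** * Sparsity *)

Section Sparsity.
Variables (R : realType) (n : nat).
Implicit Types (X Y S : symmx R n) (a : R).

(** [nnz] counts a classical set; the finite set with the same elements gives
    access to the theory of cardinals. *)
Lemma nnzE X : nnz X = #|[set p : 'I_n * 'I_n | val X p.1 p.2 != 0]%SET|.
Proof. by apply: eq_card => p; rewrite finset.in_set; apply/asboolP/idP. Qed.

Lemma nnzD X Y : (nnz (X + Y)%R <= nnz X + nnz Y)%N.
Proof.
rewrite !nnzE; apply: leq_trans (subset_leq_card _) (leq_card_setU _ _).
apply/fintype.subsetP => p; rewrite !inE -negb_and.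
by apply: contra => /andP[/eqP + /eqP]; rewrite /= mxE => -> ->; rewrite addr0.
Qed.

Lemma nnzZ a X : (nnz (a *: X)%R <= nnz X)%N.
Proof.
rewrite !nnzE; apply: subset_leq_card; apply/fintype.subsetP => p; rewrite !inE.
by apply: contra => /eqP; rewrite /= mxE => ->; rewrite mulr0.
Qed.

(** The atoms of indices [i] and [j] are supported on [{i, j} * {i, j}]. *)
Lemma nnz_atom S : sparse4_atoms S -> (nnz S <= 4)%N.
Proof.
case=> i [j [_ Sij]].
apply: (@leq_trans #|finset.setX [set i; j]%SET [set i; j]%SET|); last first.
  rewrite cardsX.
  have h : (#|[set i; j]%SET| <= 2)%N by rewrite cards2; case: (i != j).
  by rewrite (leq_mul h h).
rewrite nnzE; apply: subset_leq_card.
apply/fintype.subsetP => -[k l]; rewrite !inE /=.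
apply: contraR; rewrite negb_and !negb_or => kl.
case: Sij => ->; rewrite /= mxE big_ord1 !mxE;
  case/orP: kl => /andP[/negbTE -> /negbTE ->];
  by rewrite ?(addr0, subr0, mul0r, mulr0).
Qed.

Lemma nnz_greedy_step (f : symmx R n -> R) a X X' :
  greedy_step f a X X' -> (nnz X' <= nnz X + 4)%N.
Proof.
case=> S [/nnz_atom S4 _ ->].
have -> : X + a *: (S - X) = (1 - a) *: X + a *: S.
  by rewrite scalerBl scale1r scalerBr -!addrA; congr (_ + _); rewrite addrC.
apply: leq_trans (nnzD _ _) (leq_add (nnzZ _ _) _).
exact: leq_trans (nnzZ _ _) S4.
Qed.

End Sparsity.

(** * Scalar recurrences and step sizes *)

Section Scalars.
Variable R : realType.
Implicit Types (h : nat -> R) (C eps : R).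

Lemma step_size_in01 k : 0 < step_size R k <= 1.
Proof.
rewrite /step_size divr_gt0 ?ltr0n ?addn2 //= ler_pdivrMr ?ltr0n // mul1r.
by rewrite ler_nat.
Qed.

Lemma half_fixed_step_size_in01 K k : 0 < half_fixed_step_size R K k <= 1.
Proof.
by rewrite /half_fixed_step_size; case: ifP => _; exact: step_size_in01.
Qed.

(** The recurrence is only assumed up to [m], since in the schedule with a
    fixed second half it holds for the first half only. The bound propagates
    because [(k + 2) * (k + 4) <= (k + 3) ^+ 2]. *)
Lemma step_recurrence_bound h C m : 0 <= C ->
  (forall k, (k < m)%N ->
     h k.+1 <= (1 - step_size R k) * h k + step_size R k ^+ 2 * C) ->
  forall k, (k < m)%N -> h k.+1 <= 4 * C / (k + 3)%:R.
Proof.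
move=> C0 hrec; elim=> [|k IH] km.
  (* [step_size R 0 = 1] cancels [h 0], which is not controlled. *)
  have := hrec _ km; rewrite /step_size /= add0n divff ?pnatr_eq0 //.
  rewrite subrr mul0r add0r expr1n mul1r => /le_trans; apply.
  by rewrite ler_pdivlMr //; nra.
have {}IH := IH (ltnW km); have := hrec _ km; rewrite /step_size.
move=> /le_trans; apply.
have -> : (k.+1 + 2)%:R = k%:R + 3 :> R by rewrite addSn -addnS natrD.
have -> : (k.+1 + 3)%:R = k%:R + 4 :> R by rewrite addSn -addnS natrD.
rewrite natrD in IH.
have : 0 <= k%:R :> R by exact: ler0n.
move: (k%:R : R) IH => x; move: (h k.+1) => y yx x0.
have x3 : 0 < x + 3 by lra.
have x4 : 0 < x + 4 by lra.
apply: (@le_trans _ _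
    ((1 - 2 / (x + 3)) * (4 * C / (x + 3)) + (2 / (x + 3)) ^+ 2 * C)).
  by rewrite lerD2r ler_wpM2l // subr_ge0 ler_pdivrMr //; lra.
rewrite -subr_ge0.
have -> : 4 * C / (x + 4) -
    ((1 - 2 / (x + 3)) * (4 * C / (x + 3)) + (2 / (x + 3)) ^+ 2 * C) =
    4 * C / ((x + 4) * (x + 3) ^+ 2).
  by field; rewrite !gt_eqF.
by rewrite divr_ge0 ?mulr_ge0 ?exprn_ge0 // ?ltW.
Qed.

Lemma fixed_decrease_telescope h (d : R) p q :
  (forall k, (p <= k < p + q)%N -> h k.+1 <= h k - d) ->
  h (p + q)%N <= h p - q%:R * d.
Proof.
elim: q => [|q IH] hd; first by rewrite addn0 mul0r subr0.
rewrite addnS; apply: le_trans (hd _ _) _.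
  by rewrite leq_addr addnS ltnSn.
apply: le_trans (lerB (IH _) (lexx d)) _.
  by move=> k /andP[pk kq]; apply: hd; rewrite pk addnS ltnW.
by rewrite -natr1 mulrDl mul1r opprD addrA.
Qed.

Lemma gap_threshold_ge C eps : 0 < eps ->
  8 * C <= (gap_threshold C eps)%:R * eps.
Proof.
move=> e0; rewrite -ler_pdivrMr // /gap_threshold.
apply: le_trans (ceil_ge _) _.
by rewrite natr_absz ler_int; exact: ler_norm.
Qed.

Lemma gap_threshold_le C eps : 0 < eps ->
  (gap_threshold C eps)%:R <= 8 * `|C| / eps + 1.
Proof.
move=> e0; rewrite /gap_threshold natr_absz intr_norm.
have := ceil_ge (8 * C / eps).
have := ceilB1_lt (8 * C / eps); rewrite intrB.
have : `|8 * C / eps| = 8 * `|C| / eps.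
  by rewrite !normrM normfV (gtr0_norm e0) (@gtr0_norm _ 8).
move: (8 * C / eps) => x <- lt ge.
have := ler_norm x; have := ler_norm (- x); rewrite normrN => h1 h2.
by rewrite ler_norml; apply/andP; split; lra.
Qed.

Lemma gap_threshold_bigO C (a b : nat) :
  (fun eps : R => (a * gap_threshold C eps + b)%:R : R)
    =O_ (0^'+) (fun eps : R => eps^-1).
Proof.
apply/eqO_exP; exists (a%:R * (8 * `|C| + 1) + b%:R + 1).
  have := normr_ge0 C.
  have : 0 <= a%:R :> R by []. have : 0 <= b%:R :> R by []. nra.
near=> e.
have e0 : 0 < e by near: e; exact: nbhs_right_gt.
have e1 : e <= 1 by near: e; exact: nbhs_right_le.
rewrite /= ger0_norm // (gtr0_norm (x := e^-1)) ?invr_gt0 //.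
rewrite ler_pdivlMr // natrD natrM.
have := gap_threshold_le C e0; set g := (gap_threshold C e)%:R => gle.
have {}gle : g * e <= 8 * `|C| + e.
  by have := ler_wpM2r (ltW e0) gle; rewrite mulrDl divfK ?gt_eqF // mul1r.
have : 0 <= a%:R :> R by []. have : 0 <= b%:R :> R by [].
nra.
Unshelve. all: by end_near. Qed.

End Scalars.

(** * Runs of the greedy algorithm *)

Section GreedyRun.
Variables (R : realType) (n : nat) (f : symmx R n -> R) (C : R).
Variable Xopt : symmx R n.
Hypotheses (cf : convex_function setT f) (df : forall Y, differentiable f Y).
Hypotheses (fC : curvature f (@sparse4 R n) = C%:E) (Dopt : sparse4 Xopt).

Section Schedule.
Variables (X : nat -> symmx R n) (a : nat -> R) (m : nat).
Hypotheses (a01 : forall k, 0 < a k <= 1) (aX0 : sparse4_atoms (X 0%N)).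
Hypothesis stepX : forall k, (k < m)%N -> greedy_step f (a k) (X k) (X k.+1).

Lemma greedy_run_sparse4 k : (k <= m)%N -> sparse4 (X k).
Proof.
elim: k => [_|k IH km]; first exact: sub_gen_smallest.
apply: greedy_step_sparse4 (IH (ltnW km)) _ (stepX km).
by have /andP[/ltW -> ->] := a01 k.
Qed.

Lemma greedy_run_nnz k : (k <= m)%N -> (nnz (X k) <= 4 * (k + 1))%N.
Proof.
elim: k => [_|k IH km]; first exact: nnz_atom.
apply: leq_trans (nnz_greedy_step (stepX km)) _.
by rewrite addSn mulnS addnC leq_add2l IH // ltnW.
Qed.

(** Only the steps before [p] need the decreasing sizes, so that this applies
    both to the pure schedule and to the first half of the mixed one. *)
Lemma greedy_run_rate p k : (p <= m)%N ->
  (forall k, (k < p)%N -> a k = step_size R k) ->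
  (k < p)%N -> f (X k.+1) - f Xopt <= 4 * C / (k + 3)%:R.
Proof.
move=> pm aE; move: k.
apply: (step_recurrence_bound (h := fun k => f (X k) - f Xopt)
  (curvature_ge0 fC Dopt)) => k kp.
have km := leq_trans kp pm.
rewrite -aE //.
have := greedy_descent fC (greedy_run_sparse4 (ltnW km)) (a01 k) (stepX km) Dopt.
have := convex_gradient_le Xopt cf (df (X k)).
rewrite -opprB frobNl; have /andP[a0 _] := a01 k.
move: (frob _ _) => g; nra.
Qed.

End Schedule.

Lemma greedy_gap (eps : R) (X : nat -> symmx R n) :
  (forall Y, sparse4 Y -> f Xopt <= f Y) -> 0 < eps ->
  let K := gap_threshold C eps in
  sparse4_atoms (X 0%N) ->
  (forall k, (k <= 2 * K + 1)%N ->
     greedy_step f (half_fixed_step_size R K k) (X k) (X k.+1)) ->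
  exists2 k, (k <= 2 * K + 1)%N &
    (duality_gap f (@sparse4 R n) (X k) <= eps%:E)%E.
Proof.
move=> opt e0 K aX0 stepX.
have a01 := half_fixed_step_size_in01 R K.
have stepX' k : (k < (2 * K + 1).+1)%N ->
    greedy_step f (half_fixed_step_size R K k) (X k) (X k.+1).
  by rewrite ltnS; exact: stepX.
have DX := greedy_run_sparse4 a01 aX0 stepX'.
have C0 := curvature_ge0 fC Dopt.
apply: contrapT => noK.
have hd k : (K.+1 <= k < K.+1 + K.+1)%N ->
    f (X k.+1) <= f (X k) - (step_size R K * eps - step_size R K ^+ 2 * C).
  move=> /andP[Kk kK].
  have kK' : (k <= 2 * K + 1)%N.
    by rewrite mul2n -addnn addn1 -ltnS -addnS -addSn.
  have [Y DY gY] :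
      exists2 Y, sparse4 Y & eps < frob (X k - Y) (gradient f (X k)).
    apply: contrapT => noY; apply: noK; exists k => //.
    apply: ge_ereal_sup => _ [Y DY <-]; rewrite lee_fin leNgt.
    by apply/negP => gY; apply: noY; exists Y.
  have := greedy_descent fC (DX k _) (a01 k) (stepX k kK') DY.
  have -> : half_fixed_step_size R K k = step_size R K.
    by rewrite /half_fixed_step_size leqNgt Kk.
  move=> /(_ (leqW kK')) h.
  have /andP[a0 _] := step_size_in01 R K.
  nra.
have := fixed_decrease_telescope (h := fun k => f (X k)) hd.
apply/negP; rewrite -ltNge.
apply: (@lt_le_trans _ _ (f Xopt)); last first.
  by apply: opt; apply: DX; rewrite mul2n -addnn addn1 addSn addnS.
have rate : f (X K.+1) - f Xopt <= 4 * C / (K + 3)%:R.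
  apply: (greedy_run_rate a01 aX0 stepX' (p := K.+1)) => //.
    by rewrite ltnS mul2n -addnn addn1 leqW ?leq_addr.
  by move=> k kK; rewrite /half_fixed_step_size -ltnS kK.
have := gap_threshold_ge C e0.
move: rate; rewrite -/K /step_size -[K.+1%:R]natr1 !natrD.
have : 0 <= K%:R :> R by [].
move: (f (X K.+1)) (f Xopt) (K%:R : R) => u v x x0 uv Ce.
have x3 : 0 < x + 3 by lra.
have x2 : 0 < x + 2 by lra.
have uv2 : u - v < eps / 2.
  by apply: le_lt_trans uv _; rewrite ltr_pdivrMr //; nra.
have : 2 / (x + 2) * (x + 2) = 2 by rewrite divfK ?gt_eqF.
have : 0 < 2 / (x + 2) by rewrite divr_gt0.
move: (2 / (x + 2)) => b b0 bx.
(* The [K + 1] steps gain at least [eps] and lose less than [eps / 2] to the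
   curvature. *)
have be : eps <= (x + 1) * (b * eps) by nra.
have bC : (x + 1) * (b ^+ 2 * C) < eps / 2.
  apply: (@le_lt_trans _ _ (2 * b * C)).
    have bbC : 0 <= b ^+ 2 * C by rewrite mulr_ge0 // exprn_ge0 // ltW.
    have -> : 2 * b * C = b * (x + 2) * b * C by rewrite bx.
    nra.
  have bxe : b * x * eps < 2 * eps by rewrite ltr_pM2r //; nra.
  have : b * (8 * C) <= b * (x * eps) by rewrite ler_pM2l.
  lra.
lra.
Qed.

End GreedyRun.

(* The existential bound [s] on the number of non-zero entries precedes the
   quantification over [n], [f] and the runs: the constant hidden in each O
   depends on [C] only. *)
Theorem theorem26 (R : realType) (C : R) :
  (fun eps : R => (2 * gap_threshold C eps + 1)%:R : R)
    =O_ (0^'+) (fun eps : R => eps^-1) /\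
  exists2 s : R -> R, s =O_ (0^'+) (fun eps : R => eps^-1) &
    forall (n : nat) (n_ge2 : (1 < n)%N) (f : symmx R n -> R)
      (Xopt : symmx R n),
      convex_function setT f ->
      (forall X, differentiable f X) ->
      curvature f (@sparse4 R n) = C%:E ->
      sparse4 Xopt ->
      (forall X, sparse4 X -> f Xopt <= f X) ->
      let X0 := P_mx R (Ordinal (ltnW n_ge2)) (Ordinal n_ge2) in
      (forall X : nat -> symmx R n,
         X 0%N = X0 ->
         (forall k, greedy_step f (step_size R k) (X k) (X k.+1)) ->
         forall k, (1 <= k)%N ->
           (nnz (X k) <= 4 * (k + 1))%N /\
           f (X k) - f Xopt <= 8 * C / (k + 2)%:R) /\
      (forall eps : R, 0 < eps ->
         let K := gap_threshold C eps in
         forall X : nat -> symmx R n,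
         X 0%N = X0 ->
         (forall k, (k <= 2 * K + 1)%N ->
            greedy_step f (half_fixed_step_size R K k) (X k) (X k.+1)) ->
         exists k, [/\ (k <= 2 * K + 1)%N, (nnz (X k))%:R <= s eps &
           (duality_gap f (@sparse4 R n) (X k) <= eps%:E)%E]).
Proof.
split; first exact: gap_threshold_bigO.
(* At most [2 * K + 1] steps are made, and [4 * ((2 * K + 1) + 1) = 8 * K + 8]. *)
exists (fun eps => (8 * gap_threshold C eps + 8)%:R).
  exact: gap_threshold_bigO.
move=> n n_ge2 f Xopt cf df fC Dopt opt X0.
have aX0 : sparse4_atoms X0.
  by exists (Ordinal (ltnW n_ge2)), (Ordinal n_ge2); split; last left.
split=> [X XX0 stepX k k1 | eps e0 K X XX0 stepX].
  have a01 := step_size_in01 R.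
  rewrite -XX0 in aX0; have stepX' j (_ : (j < k)%N) := stepX j.
  split; first exact: (greedy_run_nnz aX0 stepX').
  case: k k1 stepX' => // k _ stepX'.
  have rate := greedy_run_rate cf df fC Dopt a01 aX0 stepX' (leqnn _)
    (fun _ _ => erefl) (ltnSn k).
  apply: le_trans rate _; rewrite addSnnS ler_pM2r ?invr_gt0 ?ltr0n ?addnS //.
  have := curvature_ge0 fC Dopt; lra.
rewrite -XX0 in aX0.
have [k kK gk] := greedy_gap cf df fC Dopt opt e0 aX0 stepX.
exists k; split=> //.
have stepX' j : (j < (2 * K + 1).+1)%N ->
    greedy_step f (half_fixed_step_size R K j) (X j) (X j.+1).
  by rewrite ltnS; exact: stepX.
rewrite ler_nat; apply: leq_trans (greedy_run_nnz aX0 stepX' (leqW kK)) _.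
apply: leq_trans (leq_mul (leqnn 4) (leq_add kK (leqnn 1))) _.
by rewrite -/K -addnA mulnDr mulnA.
Qed.
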